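(* Let $n\ge 4$ be an integer and let $m=\lfloor (n-2)/2\rfloor$. If $n\equiv 0,1 \pmod 4$, then both polynomials $R_n^{+}(t)$ and $R_n^{-}(t)$ are divisible by $(1+t)^{m-1}$. If $n\equiv 2,3\pmod 4$, then both $R_n^{+}(t)$ and $R_n^{-}(t)$ are divisible by $(1+t)^{m}$.
   Context: For $\pi=\pi_1\cdots\pi_n\in\mathfrak{S}_n$ (one-line notation), let $\mathrm{inv}(\pi)=|\{i<j:\pi_i>\pi_j\}|$; let $\mathrm{pk}(\pi)$ be the number of indices $2\le i\le n-1$ with $\pi_{i-1}<\pi_i>\pi_{i+1}$ and $\mathrm{val}(\pi)$ the number of indices $2\le i\le n-1$ with $\pi_{i-1}>\pi_i<\pi_{i+1}$. The number of alternating runs is $\mathrm{altruns}(\pi)=\mathrm{pk}(\pi)+\mathrm{val}(\pi)+1$. Let $\mathcal{A}_n$ be the set of $\pi\in\mathfrak{S}_n$ with $\mathrm{inv}(\pi)$ even. Define $R_n^+(t)=\sum_{\pi\in\mathcal{A}_n}t^{\mathrm{altruns}(\pi)}$ and $R_n^-(t)=\sum_{\pi\in\mathfrak{S}_n\setminus\mathcal{A}_n}t^{\mathrm{altruns}(\pi)}$. *)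

(* Defs.v *)
From mathcomp Require Import all_boot all_order all_fingroup all_algebra.

Set Implicit Arguments.
Unset Strict Implicit.
Unset Printing Implicit Defensive.

Import GRing.Theory.

Local Open Scope nat_scope.

(* Positions and values are 0-based: the one-line notation of s : 'S_n is      *)
(* s 0, ..., s (n - 1), values being compared as natural numbers.              *)

Definition perm_inversions (n : nat) (s : 'S_n) : {set 'I_n * 'I_n} :=
  [set p : 'I_n * 'I_n | (p.1 < p.2) && (s p.2 < s p.1)].

Definition perm_inv_count (n : nat) (s : 'S_n) : nat := #|perm_inversions s|.

(* Requiring both neighbours h and k of i to lie in 'I_n excludes the first    *)
(* and the last position.                                                      *)
Definition peaks (n : nat) (s : 'S_n) : {set 'I_n} :=
  [set i : 'I_n | [exists h : 'I_n, exists k : 'I_n,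
     [&& h.+1 == i :> nat, i.+1 == k :> nat, s h < s i & s k < s i]]].

Definition valleys (n : nat) (s : 'S_n) : {set 'I_n} :=
  [set i : 'I_n | [exists h : 'I_n, exists k : 'I_n,
     [&& h.+1 == i :> nat, i.+1 == k :> nat, s i < s h & s i < s k]]].

Definition altruns (n : nat) (s : 'S_n) : nat := #|peaks s| + #|valleys s| + 1.

(* Evenness is that of the inversion number, not the library's odd_perm, which *)
(* is computed from the number of cycles.                                      *)
Definition even_perms (n : nat) : {set 'S_n} :=
  [set s : 'S_n | ~~ odd (perm_inv_count s)].

Local Open Scope ring_scope.

Definition Rplus (n : nat) : {poly int} :=
  \sum_(s in even_perms n) 'X^(altruns s).

Definition Rminus (n : nat) : {poly int} :=
  \sum_(s in ~: even_perms n) 'X^(altruns s).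

(* Divisibility in the ring Z[t]; the library's %| on {poly int} is            *)
(* pseudo-divisibility, which allows p to be first multiplied by a nonzero     *)
(* integer.                                                                    *)
Definition divides_Zpoly (d p : {poly int}) : Prop :=
  exists q : {poly int}, p = q * d.

(* Main.v *)
(* Both R = R+ + R- and D = R+ - R- are summed over orbits of commuting
   involutions, each orbit sum being a product of binomials t^a +- t^b.
   For R the involutions replace a suffix by its order reversal (Bona): doing so
   from position 2i+2 flips the parity of the number of turns at positions 2i+1
   and 2i+2 and preserves all other turns, so each i < m contributes a factor
   1 + t. For D the involutions exchange the values 2i and 2i+1, which flips the
   sign and, unless one of these values is at an end, preserves the parity of the
   number of turns at them; at most two of the n/2 factors 1 + t are lost.
   If n = 2, 3 (mod 4), complementing the values flips the sign and D = 0. *)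
Require Import Defs.
From mathcomp Require Import all_boot all_order all_fingroup all_algebra.
From mathcomp Require Import zify ring.

Set Implicit Arguments.
Unset Strict Implicit.
Unset Printing Implicit Defensive.

Import GRing.Theory Num.Theory.

Local Open Scope ring_scope.

(** * Divisibility in Z[t] and symmetrization of sums of products *)

Lemma divides_Zpoly_sum (I : Type) (s : seq I) (P : pred I) (d : {poly int})
    (F : I -> {poly int}) :
  (forall i, P i -> divides_Zpoly d (F i)) ->
  divides_Zpoly d (\sum_(i <- s | P i) F i).
Proof.
move=> dF; elim/big_ind: _ => [|p q [u ->] [v ->]|//].
  by exists 0; rewrite mul0r.
by exists (u + v); rewrite mulrDl.
Qed.

Lemma divides_Zpoly_mull (d p q : {poly int}) :
  divides_Zpoly d q -> divides_Zpoly d (p * q).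
Proof. by case=> u ->; exists (p * u); rewrite mulrA. Qed.

Lemma divides_Zpoly_prod (I : finType) (P : pred I) (d : {poly int})
    (F : I -> {poly int}) k :
  (k <= #|[pred i | P i]|)%N ->
  (forall i, P i -> divides_Zpoly d (F i)) ->
  divides_Zpoly (d ^+ k) (\prod_i F i).
Proof.
move=> le_k dF; rewrite (bigID P) /= mulrC; apply: divides_Zpoly_mull.
have [q ->]: divides_Zpoly (d ^+ #|[pred i | P i]|) (\prod_(i | P i) F i).
  rewrite -sum1_card -prodrXr.
  elim/big_ind2: _ => [|p u q v [p' ->] [q' ->]|i /dF [q ->]].
  - by exists 1; rewrite mulr1.
  - by exists (p' * q'); rewrite mulrACA.
  - by exists q; rewrite expr1.
by exists (q * d ^+ (#|[pred i | P i]| - k)); rewrite -mulrA -exprD subnK.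
Qed.

(** This cancels the powers of 2 that symmetrizing introduces. Division by a monic [d] works over
    the integers; [k] times the remainder is a multiple of [d] of degree below that of [d], hence
    zero. *)
Lemma divides_Zpoly_mulrn (d p : {poly int}) k :
  d \is monic -> (0 < k)%N ->
  divides_Zpoly d (p *+ k) -> divides_Zpoly d p.
Proof.
move=> mon_d k_gt0 [q def_q].
have def_p := Pdiv.RingMonic.rdivp_eq mon_d p.
set u := Pdiv.Ring.rdivp p d in def_p; set r := Pdiv.Ring.rmodp p d in def_p.
have lt_r : (size r < size d)%N by rewrite Pdiv.Ring.ltn_rmodpN0 ?monic_neq0.
suff r0 : r = 0 by exists u; rewrite def_p r0 addr0.
have def_r : r *+ k = (q - u *+ k) * d.
  by rewrite mulrBl -def_q [in RHS]def_p mulrnDl mulrnAl addrAC subrr add0r.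
have [v0|v_neq0] := eqVneq (q - u *+ k) 0.
  by apply/eqP; move/eqP: def_r; rewrite v0 mul0r -mulr_natr mulf_eq0
    => /orP[//|]; rewrite -polyC_natr polyC_eq0 pnatr_eq0 eqn0Ngt k_gt0.
have := size_Mmonic v_neq0 mon_d; rewrite -def_r => sz.
have le_sz : (size (r *+ k)%R <= size r)%N by rewrite -scaler_nat size_scale_leq.
move: (leq_ltn_trans le_sz lt_r); rewrite sz.
move: v_neq0; rewrite -size_poly_gt0; case: (size _) => // a _.
by rewrite addSn ltnNge leq_addl.
Qed.

Lemma monic_1DX : (1 + 'X : {poly int}) \is monic.
Proof. by rewrite addrC -[1]opprK -polyCN monicXsubC. Qed.

Lemma divides_1DX (p : {poly int}) : p.[-1] = 0 -> divides_Zpoly (1 + 'X) p.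
Proof.
move/eqP/factor_theorem=> [q ->]; exists q.
by rewrite polyCN opprK addrC.
Qed.

(* Symmetrizing under c_0, ..., c_(k-1) in this order, the last hypothesis is
   needed for i < j only; the c_i need not commute. *)
Lemma sum_prod_symmetrize (T : finType) (A : comNzRingType) (eps : A) (k : nat)
    (c : nat -> T -> T) (r : T -> A) (F : nat -> T -> A) :
  (forall i, (i < k)%N -> injective (c i)) ->
  (forall i x, (i < k)%N -> r (c i x) = eps * r x) ->
  (forall i j x, (i < k)%N -> (j < k)%N -> i != j -> F i (c j x) = F i x) ->
  (forall i j x, (i < j < k)%N -> F i (c i (c j x)) = F i (c i x)) ->
  (\sum_x r x * \prod_(i < k) F i x) *+ 2 ^ k =
  \sum_x r x * \prod_(i < k) (F i x + eps * F i (c i x)).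
Proof.
move=> c_inj r_c F_c F_cc; pose G i x := F i x + eps * F i (c i x).
(* Induction on the number [l] of factors already symmetrized. *)
suff H l : (l <= k)%N -> (\sum_x r x * \prod_(i < k) F i x) *+ 2 ^ l =
    \sum_x r x * ((\prod_(0 <= i < l) G i x) * \prod_(l <= i < k) F i x).
  by rewrite H //; apply: eq_bigr => x _; rewrite (big_geq (leqnn k)) mulr1 big_mkord.
elim: l => [_|l IHl lt_lk].
  by rewrite mulr1n; apply: eq_bigr => x _; rewrite big_nil mul1r big_mkord.
rewrite expnSr mulrnA IHl 1?ltnW // mulr2n.
(* One of the two copies of the sum is reindexed by [c l]. Only [r] and the factor of index [l] see
   the change. *)
rewrite [X in _ + X](reindex_inj (c_inj _ lt_lk)) -big_split /=.
apply: eq_bigr => x _; rewrite r_c // (big_ltn lt_lk) (big_ltn lt_lk).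
rewrite big_nat_recr //= {4}/G.
have ->: \prod_(0 <= i < l) G i (c l x) = \prod_(0 <= i < l) G i x.
  apply: eq_big_nat => i /= lt_il; have lt_ik := ltn_trans lt_il lt_lk.
  by rewrite /G F_c ?F_cc ?lt_il //; lia.
have ->: \prod_(l.+1 <= i < k) F i (c l x) = \prod_(l.+1 <= i < k) F i x.
  by apply: eq_big_nat => i /andP[lt_li lt_ik]; rewrite F_c //; lia.
set g := \prod_(0 <= i < l) _; set f := \prod_(l.+1 <= i < k) _.
ring.
Qed.

Lemma prod_nat_pairs (A : comNzRingType) (a : nat -> A) b k :
  \prod_(b <= i < b + k.*2) a i =
  \prod_(i < k) (a (b + i.*2)%N * a (b + i.*2).+1).
Proof.
elim: k => [|k IHk]; first by rewrite addn0 big_geq // big_ord0.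
by rewrite doubleS !addnS !big_nat_recr /= ?IHk ?big_ord_recr /= ?mulrA //; lia.
Qed.

(** * Turns *)

Definition ascent (n : nat) (s : 'S_n.+1) (k : nat) : bool :=
  (s (inord k) < s (inord k.+1))%N.

(** Peaks and valleys in one predicate on natural numbers. The guards matter because [p.-1] and
    [inord p.+1] are not true neighbours of [p] at the two ends. *)
Definition turn (n : nat) (s : 'S_n.+1) (p : nat) : bool :=
  [&& (0 < p)%N, (p < n)%N & ascent s p.-1 (+) ascent s p].

Lemma perm_ltnN (n : nat) (s : 'S_n) (a b : 'I_n) :
  a != b -> (s b < s a)%N = ~~ (s a < s b)%N.
Proof.
by rewrite -(inj_eq (@perm_inj _ s)) -val_eqE /=; lia.
Qed.

Lemma inord_neqS n k : (k < n)%N -> (inord k : 'I_n.+1) != inord k.+1.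
Proof. by move=> lt_kn; rewrite -val_eqE /= !inordK; lia. Qed.

Lemma mem_peaks n (s : 'S_n.+1) (i : 'I_n.+1) :
  (i \in peaks s) = [&& (0 < i)%N, (i < n)%N, ascent s i.-1 & ~~ ascent s i].
Proof.
rewrite inE; apply/existsP/and4P=> [[h /existsP[k]]|[i_gt0 lt_in]].
  case/and4P=> /eqP hi /eqP ik ltsh ltsk; have ltk := ltn_ord k.
  have -> : (0 < i)%N by lia.
  have lt_in : (i < n)%N by lia.
  rewrite lt_in /ascent -hi /= inord_val hi inord_val ltsh.
  by rewrite -perm_ltnN ?ik ?inord_val ?ltsk // -val_eqE /=; lia.
rewrite /ascent (ltn_predK i_gt0) inord_val => up dn.
exists (inord i.-1); apply/existsP; exists (inord i.+1).
rewrite !inordK ?(ltn_predK i_gt0) ?eqxx ?up //=; try lia.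
by rewrite perm_ltnN // -val_eqE /= inordK; lia.
Qed.

Lemma mem_valleys n (s : 'S_n.+1) (i : 'I_n.+1) :
  (i \in valleys s) = [&& (0 < i)%N, (i < n)%N, ~~ ascent s i.-1 & ascent s i].
Proof.
rewrite inE; apply/existsP/and4P=> [[h /existsP[k]]|[i_gt0 lt_in]].
  case/and4P=> /eqP hi /eqP ik ltsh ltsk; have ltk := ltn_ord k.
  have -> : (0 < i)%N by lia.
  have lt_in : (i < n)%N by lia.
  rewrite lt_in /ascent -hi /= inord_val hi inord_val ik inord_val ltsk.
  by rewrite -perm_ltnN // -val_eqE /=; lia.
rewrite /ascent (ltn_predK i_gt0) inord_val => dn up.
exists (inord i.-1); apply/existsP; exists (inord i.+1).
rewrite !inordK ?(ltn_predK i_gt0) ?eqxx ?up ?andbT //=; try lia.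
by rewrite perm_ltnN // -val_eqE /= inordK; lia.
Qed.

Lemma altruns_turn n (s : 'S_n.+1) :
  altruns s = (\sum_(p < n.+1) turn s p).+1.
Proof.
rewrite /altruns addn1 -!sum1_card [X in (X + _)%N]big_mkcond.
rewrite [X in (_ + X)%N]big_mkcond /= -big_split /=.
congr _.+1; apply: eq_bigr => i _; rewrite mem_peaks mem_valleys /turn.
by case: (0 < i)%N => //; case: (i < n)%N => //; do 2!case: (ascent _ _).
Qed.

Lemma turn_id n (s s' : 'S_n.+1) p :
  (forall k : 'I_n.+1, (p.-1 <= k <= p.+1)%N -> s' k = s k) ->
  turn s' p = turn s p.
Proof.
move=> eqs; rewrite /turn; case: ltnP => //= p_gt0; case: ltnP => //= lt_pn.
by rewrite /ascent (ltn_predK p_gt0) !eqs // inordK; lia.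
Qed.

(** The comparisons are assumed reversed only from position [k] on, so that the lemma serves both
    suffix reversal and full complementation. *)
Lemma ascent_anti n (s s' : 'S_n.+1) k :
  (k < n)%N ->
  (forall a b : 'I_n.+1, (k <= a)%N -> (k <= b)%N ->
    (s' a < s' b)%N = (s b < s a)%N) ->
  ascent s' k = ~~ ascent s k.
Proof.
move=> lt_kn anti; rewrite /ascent anti ?inordK //; try lia.
by rewrite -perm_ltnN // inord_neqS.
Qed.

Lemma turn_anti n (s s' : 'S_n.+1) p :
  (forall a b : 'I_n.+1, (p.-1 <= a)%N -> (p.-1 <= b)%N ->
    (s' a < s' b)%N = (s b < s a)%N) ->
  turn s' p = turn s p.
Proof.
move=> anti; rewrite /turn; case: ltnP => //= p_gt0; case: ltnP => //= lt_pn.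
have -> : ascent s' p.-1 = ~~ ascent s p.-1 by apply: ascent_anti => //; lia.
have -> : ascent s' p = ~~ ascent s p.
  by apply: ascent_anti => // a b ? ?; apply: anti; lia.
by rewrite addNb addbN negbK.
Qed.

(** * Order reversal of a suffix *)

Section OrderReversal.

Variables (n : nat) (S : {set 'I_n}).

Let e : seq 'I_n := enum S.

(** The order-reversing bijection of [S], extended by the identity: [enum S] is increasing, so
    counting from its other end reverses ranks. *)
Definition rev_in (v : 'I_n) : 'I_n :=
  if v \in S then nth v e (size e - (index v e).+1) else v.

Let ltI : rel 'I_n := relpre val ltn.

Let mem_e (v : 'I_n) : (v \in e) = (v \in S). Proof. exact: mem_enum. Qed.

Let sorted_e : sorted ltI e.
Proof.
rewrite /e /enum_mem -enumT; apply: sorted_filter => [x y z|]; first exact: ltn_trans.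
by rewrite -sorted_map val_enum_ord iota_ltn_sorted.
Qed.

Let index_e (v : 'I_n) : v \in S -> (index v e < size e)%N.
Proof. by rewrite index_mem mem_e. Qed.

Lemma rev_in_mem v : (rev_in v \in S) = (v \in S).
Proof.
rewrite /rev_in; case: ifP => // Sv; rewrite -mem_e mem_nth //.
by rewrite ltn_subrL (leq_trans _ (index_e Sv)).
Qed.

Lemma rev_inK : involutive rev_in.
Proof.
move=> v; case Sv: (v \in S); last by rewrite /rev_in Sv Sv.
have lt_i := index_e Sv.
have lt_j : (size e - (index v e).+1 < size e)%N.
  by rewrite ltn_subrL (leq_trans _ lt_i).
rewrite {1}/rev_in rev_in_mem Sv /rev_in Sv (index_uniq v lt_j (enum_uniq _)).
rewrite subnSK // subKn; last exact: ltnW.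
rewrite (set_nth_default v) //.
by rewrite nth_index // mem_e.
Qed.

Lemma rev_in_homo : {in S &, {homo rev_in : u v / (u < v)%N >-> (v < u)%N}}.
Proof.
have tr : transitive ltI by move=> x y z; apply: ltn_trans.
move=> u v Su Sv lt_uv; have iu := index_e Su; have iv := index_e Sv.
have ltj (i : nat) : (i < size e)%N -> (size e - i.+1 < size e)%N by lia.
rewrite /rev_in Su Sv (set_nth_default u v); last exact: ltj.
apply: (sorted_ltn_nth tr u sorted_e); rewrite ?inE ?ltj //.
(* In a sorted list, ranks compare as the elements do; equal or inverted ranks would contradict
   [u < v]. *)
suff: (index u e < index v e)%N by move=> lt_i; rewrite ltn_sub2l // (leq_ltn_trans _ iv).
rewrite ltnNge leq_eqVlt; apply/norP; split.
  apply/eqP=> eq_i; move: lt_uv.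
  by rewrite -(nth_index u (s := e) (x := v)) ?mem_e // eq_i nth_index
    ?mem_e // ltnn.
apply/negP=> lt_i; have := sorted_ltn_index tr sorted_e.
by move/(_ v u); rewrite !mem_e => /(_ Sv Su lt_i); rewrite /ltI /=; lia.
Qed.

Lemma rev_in_anti : {in S &, forall u v, (rev_in u < rev_in v)%N = (v < u)%N}.
Proof.
move=> u v Su Sv; apply/idP/idP => [|lt_vu]; last exact: rev_in_homo.
by move/rev_in_homo; rewrite !rev_inK; apply; rewrite rev_in_mem.
Qed.

Definition rev_perm : 'S_n := perm (can_inj rev_inK).

Lemma rev_perm_imset (S' : {set 'I_n}) : S \subset S' -> rev_perm @: S' = S'.
Proof.
move=> /subsetP sSS'; apply/eqP; rewrite eqEcard card_imset ?leqnn ?andbT;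
  last exact: perm_inj.
apply/subsetP=> _ /imsetP[v S'v ->]; rewrite permE.
by case Sv: (v \in S); [apply: sSS'; rewrite rev_in_mem | rewrite /rev_in Sv].
Qed.

End OrderReversal.

Definition suffix_set n (s : 'S_n) (j : nat) : {set 'I_n} :=
  [set s k | k : 'I_n & (j <= k)%N].

(** The right factor acts on values: the entries from position [j] on are reversed in rank among
    themselves, and the others stay. *)
Definition rev_suffix n (j : nat) (s : 'S_n) : 'S_n :=
  (s * rev_perm (suffix_set s j))%g.

Lemma mem_suffix_set n (s : 'S_n) j k : (s k \in suffix_set s j) = (j <= k)%N.
Proof. by rewrite mem_imset ?inE //; apply: perm_inj. Qed.

Lemma rev_suffix_low n j (s : 'S_n) (k : 'I_n) :
  (k < j)%N -> rev_suffix j s k = s k.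
Proof. by move=> lt_kj; rewrite permM permE /rev_in mem_suffix_set leqNgt lt_kj. Qed.

Lemma rev_suffix_anti n j (s : 'S_n) (a b : 'I_n) :
  (j <= a)%N -> (j <= b)%N ->
  (rev_suffix j s a < rev_suffix j s b)%N = (s b < s a)%N.
Proof. by move=> le_ja le_jb; rewrite !permM !permE rev_in_anti ?mem_suffix_set. Qed.

Lemma suffix_set_rev_suffix n i j (s : 'S_n) :
  (i <= j)%N -> suffix_set (rev_suffix j s) i = suffix_set s i.
Proof.
move=> le_ij; rewrite /suffix_set.
rewrite (eq_imset _ (g := rev_perm (suffix_set s j) \o s)); last first.
  by move=> k; rewrite /= permM.
rewrite imset_comp rev_perm_imset //; apply/subsetP=> _ /imsetP[k jk ->].
by apply: imset_f; move: jk; rewrite !inE; apply: leq_trans.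
Qed.

Lemma rev_suffixK n j : involutive (@rev_suffix n j).
Proof.
move=> s; apply/permP=> k; rewrite permM suffix_set_rev_suffix // permM !permE.
exact: rev_inK.
Qed.

(** Reversing from [j] changes neither the entry at [k] nor the set of entries from [i] on, and
    these determine the left side. This stands in for commutation in the symmetrization. *)
Lemma rev_suffix_agree n i j (s : 'S_n) (k : 'I_n) : (i <= j)%N -> (k < j)%N ->
  rev_suffix i (rev_suffix j s) k = rev_suffix i s k.
Proof.
by move=> le_ij lt_kj; rewrite permM suffix_set_rev_suffix // rev_suffix_low // permM.
Qed.

(** Position [p] and its neighbours lie either all before the suffix, where nothing moves, or all
    inside it, where peaks and valleys are exchanged. Only positions [j - 1] and [j] escape. *)
Lemma turn_rev_suffix n j (s : 'S_n.+1) p :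
  (p.+1 < j)%N || (j < p)%N -> turn (rev_suffix j s) p = turn s p.
Proof.
case/orP=> [lt_pj | lt_jp]; [apply: turn_id => k ? | apply: turn_anti => a b ? ?].
  by apply: rev_suffix_low; lia.
by apply: rev_suffix_anti; lia.
Qed.

Lemma ascent_rev_suffix_low n j (s : 'S_n.+1) k :
  (k.+1 < j)%N -> (k < n)%N -> ascent (rev_suffix j s) k = ascent s k.
Proof. by move=> ? ?; rewrite /ascent !rev_suffix_low // inordK; lia. Qed.

Lemma ascent_rev_suffix n j (s : 'S_n.+1) k :
  (j <= k)%N -> (k < n)%N -> ascent (rev_suffix j s) k = ~~ ascent s k.
Proof.
by move=> le_jk lt_kn; apply: ascent_anti => // a b ? ?; apply: rev_suffix_anti; lia.
Qed.

(** * Divisibility of the unsigned sum *)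

Lemma prod_Xn_altruns n (s : 'S_n.+1) :
  'X^(altruns s) = 'X * \prod_(p < n.+1) 'X^(turn s p) :> {poly int}.
Proof. by rewrite altruns_turn exprS -prodrXr. Qed.

Lemma horner_Xn_turn n (s : 'S_n.+1) p :
  ('X^(turn s p) : {poly int}).[-1] = (-1) ^+ turn s p.
Proof. by rewrite hornerXn. Qed.

Lemma divides_sum_altruns n m : (m.*2 < n)%N ->
  divides_Zpoly ((1 + 'X) ^+ m) (\sum_(s : 'S_n.+1) 'X^(altruns s)).
Proof.
move=> lt_mn.
pose c i : 'S_n.+1 -> 'S_n.+1 := rev_suffix i.*2.+2.
pose r (s : 'S_n.+1) : {poly int} := 'X * \prod_(m.*2.+1 <= p < n.+1) 'X^(turn s p).
pose F i (s : 'S_n.+1) : {poly int} := 'X^(turn s i.*2.+1) * 'X^(turn s i.*2.+2).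
have -> : \sum_(s : 'S_n.+1) 'X^(altruns s) = \sum_s r s * \prod_(i < m) F i s.
  apply: eq_bigr => s _; rewrite prod_Xn_altruns /r -mulrA; congr (_ * _).
  (* Position 0 is never a turn, so its factor is 1 and the pairing of positions starts at 1. *)
  rewrite -(big_mkord xpredT (fun p => 'X^(turn s p))) big_ltn // mul1r.
  rewrite (big_cat_nat (n := m.*2.+1)) /=; [|lia|lia].
  rewrite mulrC; congr (_ * _).
  exact: (prod_nat_pairs (fun p => 'X^(turn s p)) 1).
apply: (@divides_Zpoly_mulrn _ _ (2 ^ m)); rewrite ?expn_gt0 //.
  by rewrite monic_exp ?monic_1DX.
rewrite (@sum_prod_symmetrize _ _ 1 m c r F); first last.
- move=> i j s /andP[lt_ij _]; rewrite /F /c.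
  (* [F i] depends on positions [2i] to [2i+3] only, all before [2j+2] when [i < j]. *)
  by congr ('X^_ * 'X^_); congr nat_of_bool; apply: turn_id => k ?;
    apply: rev_suffix_agree; lia.
- move=> i j s _ _ ne_ij; rewrite /F /c.
  by congr ('X^_ * 'X^_); congr nat_of_bool; apply: turn_rev_suffix; lia.
- move=> i s lt_im; rewrite mul1r /r; congr (_ * _); apply: eq_big_nat => p le_p.
  by rewrite turn_rev_suffix //; lia.
- by move=> i _; apply: inv_inj; apply: rev_suffixK.
apply: divides_Zpoly_sum => s _; apply: divides_Zpoly_mull.
apply: (@divides_Zpoly_prod _ xpredT) => [|i _]; first by rewrite card_ord.
have lt_im := ltn_ord i; apply: divides_1DX; rewrite mul1r /F /c.
rewrite hornerD !hornerM !horner_Xn_turn -!signr_addb /turn /=.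
have [-> ->] : (i.*2.+1 < n)%N /\ (i.*2.+2 < n)%N by split; lia.
(* The ascent at [2i+1] enters both turns and cancels from their parity. Of the other two, the one
   at [2i] is kept and the one at [2i+2] is flipped, so the two values at -1 are opposite. *)
set s' := rev_suffix _ _.
have -> : ascent s' i.*2 = ascent s i.*2 by apply: ascent_rev_suffix_low; lia.
have -> : ascent s' i.*2.+2 = ~~ ascent s i.*2.+2 by apply: ascent_rev_suffix; lia.
by do 4!case: (ascent _ _).
Qed.

(** * The signed sum *)

(** No value lies strictly between [a] and [b], so exchanging them affects only their mutual
    comparison. *)
Lemma tperm_lt n (a b u v : 'I_n) : b = a.+1 :> nat ->
  (tperm a b u < tperm a b v)%N =
  (u < v)%N (+) ((u == a) && (v == b) || (u == b) && (v == a)).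
Proof.
rewrite -!val_eqE /= => def_b.
by case: tpermP => [->|->|/eqP + /eqP +]; case: tpermP => [->|->|/eqP + /eqP +];
  rewrite -?val_eqE /=; lia.
Qed.

Lemma signr_perm_inv n (s : 'S_n) : (-1) ^+ perm_inv_count s =
  \prod_(x : 'I_n * 'I_n) (-1) ^+ ((x.1 < x.2) && (s x.2 < s x.1))%N :> {poly int}.
Proof.
rewrite /perm_inv_count -sum1_card prodrXr big_mkcond.
by congr (_ ^+ _); apply: eq_bigr => x _; rewrite inE; case: (_ && _).
Qed.

(** Writing the sign as a product over pairs of positions, each pair whose inversion status changes
    contributes -1. *)
Lemma signr_perm_inv_addb n (s s' : 'S_n) (e : pred ('I_n * 'I_n)) :
  (forall x y : 'I_n, (x < y)%N ->
    (s' y < s' x)%N = (s y < s x)%N (+) e (x, y)) ->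
  (-1) ^+ perm_inv_count s' =
  (-1) ^+ #|[pred x : 'I_n * 'I_n | (x.1 < x.2)%N && e x]| *
  (-1) ^+ perm_inv_count s :> {poly int}.
Proof.
move=> def_s'; rewrite !signr_perm_inv -sum1_card -prodrXr [X in _ = X * _]big_mkcond.
rewrite -big_split; apply: eq_bigr => -[x y] _ /=.
rewrite inE /=; case: ltnP => [lt_xy|_]; last by rewrite mul1r.
by rewrite def_s' // signr_addb mulrC; case: (e _).
Qed.

Lemma signr_perm_inv_tperm n (s : 'S_n) (a b : 'I_n) : b = a.+1 :> nat ->
  (-1) ^+ perm_inv_count (s * tperm a b)%g =
  - (-1) ^+ perm_inv_count s :> {poly int}.
Proof.
move=> def_b; pose p := (s^-1)%g a; pose q := (s^-1)%g b.
have sE x c : (s x == c) = (x == (s^-1)%g c) by rewrite (canF_eq (permK s)).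
pose e := [pred x : 'I_n * 'I_n |
  (x.1 == p) && (x.2 == q) || (x.1 == q) && (x.2 == p)].
have ne_pq : p != q by rewrite (inj_eq perm_inj) -val_eqE /=; lia.
rewrite (@signr_perm_inv_addb _ s _ e) => [|x y _]; last first.
  rewrite !permM tperm_lt // !sE /e /= -/p -/q; congr (_ (+) _).
  by case: (x == p); case: (x == q); case: (y == p); case: (y == q).
rewrite -[RHS]mulN1r; congr (_ * _).
(* The only affected pair of positions is that of [a] and [b], listed in increasing order. *)
have : (p < q)%N || (q < p)%N by move: ne_pq; rewrite -val_eqE /=; lia.
case/orP=> lt; [rewrite (eq_card (B := pred1 (p, q))) ?card1 // |
                rewrite (eq_card (B := pred1 (q, p))) ?card1 //] => -[x y];
  by rewrite !inE -[RHS]/((x == _) && (y == _)) /= -!val_eqE /=; lia.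
Qed.

Lemma card_ltn_pairs n :
  #|[pred x : 'I_n * 'I_n | (x.1 < x.2)%N]| = 'C(n, 2).
Proof.
rewrite -sum1_card.
rewrite -(pair_big_dep xpredT (fun x y : 'I_n => (x < y)%N) (fun _ _ => 1%N)) /=.
rewrite (exchange_big_dep xpredT) //= -bin2_sum big_mkord; apply: eq_bigr => y _.
by rewrite (big_ord_narrow (ltnW (ltn_ord y))) sum1_card card_ord.
Qed.

Lemma odd_bin2 n : odd 'C(n, 2) = (1 < n %% 4)%N.
Proof.
rewrite bin2; move: (divn_eq n 4) (ltn_pmod n (isT : 0 < 4)%N).
move: (n %/ 4)%N (n %% 4)%N => q [|[|[|[|]]]] // -> _; rewrite ?addnS addn0 ?succnK.
- set q' := (q * 4).-1.
  have -> : (q * 4 * q' = (q * q').*2.*2)%N by lia.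
  by rewrite doubleK odd_double.
- have -> : ((q * 4).+1 * (q * 4) = ((q * 4).+1 * q).*2.*2)%N by lia.
  by rewrite doubleK odd_double.
- have -> : ((q * 4).+2 * (q * 4).+1 = (((q * 4).+3 * q).*2.+1).*2)%N by lia.
  by rewrite doubleK /= odd_double.
- have -> : ((q * 4).+3 * (q * 4).+2 = (((q * 4 + 5) * q).*2.+3).*2)%N by lia.
  by rewrite doubleK /= odd_double.
Qed.

(** Complementing the values exchanges inversions and non-inversions, so the sign changes by -1 to
    the number of pairs, which is odd here. Turns are preserved, and the sum equals its own
    opposite. *)
Lemma signed_sum_altruns_eq0 n : (1 < n.+1 %% 4)%N ->
  \sum_(s : 'S_n.+1) (-1) ^+ perm_inv_count s * 'X^(altruns s) = 0 :> {poly int}.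
Proof.
move=> n_mod4; pose w : 'S_n.+1 := perm rev_ord_inj.
have w_lt (u v : 'I_n.+1) : (w u < w v)%N = (v < u)%N.
  by rewrite !permE /=; have := ltn_ord u; have := ltn_ord v; lia.
set D := \sum_s _; suff D0 : D = - D.
  apply/eqP; have /eqP : D *+ 2 = 0 by rewrite mulr2n {1}D0 addNr.
  by rewrite -mulr_natr mulf_eq0 -polyC_natr polyC_eq0 pnatr_eq0 orbF.
rewrite {1}/D (reindex_inj (mulIg w)) -sumrN; apply: eq_bigr => s _ /=.
have -> : altruns (s * w)%g = altruns s.
  rewrite !altruns_turn; congr _.+1; apply: eq_bigr => p _.
  by rewrite (@turn_anti _ s) // => a b _ _; rewrite !permM w_lt.
rewrite (@signr_perm_inv_addb _ s _ xpredT) => [|x y lt_xy]; last first.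
  by rewrite !permM w_lt addbT (perm_ltnN s (a := y)) ?negbK // -val_eqE /=; lia.
rewrite (eq_card (B := [pred x : 'I_n.+1 * 'I_n.+1 | (x.1 < x.2)%N])); last first.
  by move=> x; rewrite !inE andbT.
by rewrite card_ltn_pairs -signr_odd odd_bin2 n_mod4 expr1 mulN1r mulNr.
Qed.

Definition swap_values n (i : nat) : 'S_n.+1 := tperm (inord i.*2) (inord i.*2.+1).

Lemma ascent_swap_values n i (s : 'S_n.+1) k : (i.*2 < n)%N ->
  let p := (s^-1)%g (inord i.*2) in let q := (s^-1)%g (inord i.*2.+1) in
  ascent (s * swap_values n i)%g k = ascent s k (+)
   ((inord k == p) && (inord k.+1 == q) || (inord k == q) && (inord k.+1 == p)).
Proof.
move=> lt_in p q; rewrite /ascent !permM tperm_lt; last by rewrite !inordK; lia.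
by rewrite !(canF_eq (permK s)).
Qed.

(** An ascent can flip only when its two ends carry the two exchanged values, and [r] carries
    neither. *)
Lemma turn_swap_values n i (s : 'S_n.+1) (r : 'I_n.+1) : (i.*2 < n)%N ->
  r != (s^-1)%g (inord i.*2) -> r != (s^-1)%g (inord i.*2.+1) ->
  turn (s * swap_values n i)%g r = turn s r.
Proof.
move=> lt_in /negPf rp /negPf rq; rewrite /turn; case: ltnP => //= r_gt0.
case: ltnP => //= lt_rn; rewrite !ascent_swap_values // (ltn_predK r_gt0).
by rewrite inord_val rp rq !andbF !addbF.
Qed.

(** If [p] and [q] are not adjacent, no ascent changes. If they are, the one ascent between them
    flips and belongs to both turns, so the parity survives. *)
Lemma turn_swap_values_self n i (s : 'S_n.+1) : (i.*2 < n)%N ->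
  let p := (s^-1)%g (inord i.*2) in let q := (s^-1)%g (inord i.*2.+1) in
  (0 < p < n)%N -> (0 < q < n)%N ->
  turn (s * swap_values n i)%g p (+) turn (s * swap_values n i)%g q =
  turn s p (+) turn s q.
Proof.
move=> lt_in p q /andP[p_gt0 lt_pn] /andP[q_gt0 lt_qn].
rewrite /turn p_gt0 lt_pn q_gt0 lt_qn /= !ascent_swap_values // -/p -/q.
rewrite !(ltn_predK p_gt0) !(ltn_predK q_gt0) !inord_val !eqxx.
have ne_pq : (p == q) = false.
  by rewrite (inj_eq perm_inj) -val_eqE /= !inordK; lia.
have pq1 : (inord p.-1 == q) = (inord q.+1 == p).
  by rewrite -!val_eqE /= !inordK; lia.
have qp1 : (inord q.-1 == p) = (inord p.+1 == q).
  by rewrite -!val_eqE /= !inordK; lia.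
rewrite pq1 qp1 ne_pq [q == p]eq_sym ne_pq !andbF !andbT !orbF /=.
by do 2!case: (_ == _); do 4!case: (ascent _ _).
Qed.

Lemma commute_swap_values n i j : (i.*2 < n)%N -> (j.*2 < n)%N ->
  commute (swap_values n i : 'S_n.+1) (swap_values n j).
Proof.
move=> lt_in lt_jn; have [->|ne_ij] := eqVneq i j; first by [].
apply/commgP/conjg_fixP; rewrite tpermJ; congr tperm;
  by apply: tpermD; rewrite -val_eqE /= !inordK; lia.
Qed.

Lemma turn_swap_values_val n i (s : 'S_n.+1) (v : 'I_n.+1) : (i.*2 < n)%N ->
  v./2 != i ->
  turn (s * swap_values n i)%g ((s * swap_values n i)^-1%g v) =
  turn s ((s^-1)%g v).
Proof.
move=> lt_in ne_v; rewrite invMg tpermV permM tpermD.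
- by apply: turn_swap_values => //; rewrite (inj_eq perm_inj) -val_eqE /= inordK; lia.
- by rewrite -val_eqE /= inordK; lia.
- by rewrite -val_eqE /= inordK; lia.
Qed.

(** Turns are indexed by the value they carry, to match the exchanges of values. The second product
    holds the unpaired largest value when [n.+1] is odd. *)
Lemma prod_turn_val n (s : 'S_n.+1) :
  \prod_(p < n.+1) 'X^(turn s p) =
  (\prod_(i < n.+1./2) ('X^(turn s ((s^-1)%g (inord i.*2))) *
                        'X^(turn s ((s^-1)%g (inord i.*2.+1))))) *
  \prod_(n.+1./2.*2 <= v < n.+1) 'X^(turn s ((s^-1)%g (inord v))) :> {poly int}.
Proof.
rewrite (reindex_inj (@perm_inj _ (s^-1)%g)) /=.
rewrite (eq_bigr (fun v : 'I_n.+1 => 'X^(turn s ((s^-1)%g (inord v))))); last first.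
  by move=> v _; rewrite inord_val.
rewrite -(big_mkord xpredT (fun v => 'X^(turn s ((s^-1)%g (inord v))))).
rewrite (big_cat_nat (n := n.+1./2.*2)) /=; [congr (_ * _)|lia|lia].
exact: (prod_nat_pairs (fun v => 'X^(turn s ((s^-1)%g (inord v)))) 0).
Qed.

Lemma card_avoid2 h a b :
  (h - 2 <= #|[pred i : 'I_h | (i != a :> nat) && (i != b :> nat)]|)%N.
Proof.
set A := [pred i | _]; rewrite leq_subLR -{1}(card_ord h) -(cardC A).
rewrite addnC leq_add2r.
rewrite cardE -(size_map val) (@uniq_leq_size _ _ [:: a; b]) //.
  by rewrite (map_inj_uniq val_inj) enum_uniq.
move=> _ /mapP[i + ->]; rewrite mem_enum !inE /=.
by case: (_ == a); case: (_ == b).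
Qed.

Lemma divides_signed_sum_altruns n :
  divides_Zpoly ((1 + 'X) ^+ (n.+1./2 - 2))
    (\sum_(s : 'S_n.+1) (-1) ^+ perm_inv_count s * 'X^(altruns s)).
Proof.
set h := n.+1./2.
have lt_h i : (i < h)%N -> (i.*2 < n)%N by rewrite /h; lia.
pose c i (s : 'S_n.+1) : 'S_n.+1 := (s * swap_values n i)%g.
pose V (s : 'S_n.+1) v : {poly int} := 'X^(turn s ((s^-1)%g (inord v))).
pose r (s : 'S_n.+1) : {poly int} :=
  (-1) ^+ perm_inv_count s * ('X * \prod_(h.*2 <= v < n.+1) V s v).
pose F i (s : 'S_n.+1) : {poly int} := V s i.*2 * V s i.*2.+1.
have Vc i s v : (i < h)%N -> (v < n.+1)%N -> v./2 != i -> V (c i s) v = V s v.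
  by move=> lt_ih lt_v ne; rewrite /V turn_swap_values_val ?lt_h ?inordK.
have Fc i j s : (i < h)%N -> (j < h)%N -> i != j -> F i (c j s) = F i s.
  by move=> lt_ih lt_jh ne; have := lt_h i lt_ih; rewrite /F !Vc //; lia.
have -> : \sum_(s : 'S_n.+1) (-1) ^+ perm_inv_count s * 'X^(altruns s) =
    \sum_s r s * \prod_(i < h) F i s.
  apply: eq_bigr => s _; rewrite prod_Xn_altruns prod_turn_val /r -!mulrA.
  by do 2!congr (_ * _); rewrite mulrC.
apply: (@divides_Zpoly_mulrn _ _ (2 ^ h)); rewrite ?expn_gt0 //.
  by rewrite monic_exp ?monic_1DX.
rewrite (@sum_prod_symmetrize _ _ (-1) h c r F); first last.
- move=> i j s /andP[lt_ij lt_jh]; have lt_ih := ltn_trans lt_ij lt_jh.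
  (* The exchanges act on disjoint pairs of values and commute, which reduces this to the previous
     invariance. *)
  rewrite /c -mulgA (commute_swap_values (lt_h _ lt_jh) (lt_h _ lt_ih)) mulgA.
  by rewrite Fc //; lia.
- by move=> i j s; apply: Fc.
- move=> i s lt_ih; rewrite /r signr_perm_inv_tperm; last first.
    by rewrite !inordK //; have := lt_h i lt_ih; lia.
  rewrite mulN1r mulNr; congr (- (_ * (_ * _))); apply: eq_big_nat => v ?.
  by rewrite Vc //; lia.
- by move=> i _; apply: mulIg.
apply: divides_Zpoly_sum => s _; apply: divides_Zpoly_mull.
(* The pairs containing the first or the last entry are given up: an end position carries no turn,
   and the parity argument fails there. *)
have cnt := card_avoid2 h (s ord0)./2 (s ord_max)./2.
apply: (divides_Zpoly_prod cnt) => i /andP[ne0 nen].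
have lt_in := lt_h i (ltn_ord i); apply: divides_1DX; rewrite /F /c /V.
rewrite invMg tpermV !permM tpermL tpermR.
rewrite mulN1r hornerD hornerN !hornerM !horner_Xn_turn -!signr_addb.
have inner v : (v < n.+1)%N -> v./2 = i -> (0 < (s^-1)%g (inord v) < n)%N.
  move=> lt_v def_i; set p := (s^-1)%g _; have lt_p := ltn_ord p.
  have sp : s p = v :> nat by rewrite permKV inordK.
  have : p != ord0 by apply: contraNneq ne0 => p0; rewrite -p0 sp def_i.
  have : p != ord_max by apply: contraNneq nen => p0; rewrite -p0 sp def_i.
  by rewrite -!val_eqE /=; lia.
(* After the exchange the two values have swapped positions, hence [addbC]. The parities agree and
   the sign -1 makes the difference vanish at -1. *)
by rewrite [in X in _ + X]addbC turn_swap_values_self ?inner ?subrr //; lia.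
Qed.

(** * From sum and difference to the two parity classes *)

Lemma Rplus_add_Rminus n :
  Rplus n + Rminus n = \sum_(s : 'S_n) 'X^(altruns s).
Proof.
rewrite [RHS](bigID (mem (even_perms n))) /=; congr (_ + _).
by apply: eq_bigl => s; rewrite inE.
Qed.

Lemma Rplus_sub_Rminus n :
  Rplus n - Rminus n =
  \sum_(s : 'S_n) (-1) ^+ perm_inv_count s * 'X^(altruns s).
Proof.
rewrite [RHS](bigID (mem (even_perms n))) /=; congr (_ + _).
  apply: eq_bigr => s; rewrite inE => /negPf even_s.
  by rewrite -signr_odd even_s mul1r.
rewrite /Rminus -sumrN; apply: eq_big => s; rewrite !inE // negbK => odd_s.
by rewrite -signr_odd odd_s expr1 mulN1r.
Qed.

Lemma divides_Zpoly_halves (d p q : {poly int}) : d \is monic ->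
  divides_Zpoly d (p + q) -> divides_Zpoly d (p - q) ->
  divides_Zpoly d p /\ divides_Zpoly d q.
Proof.
move=> mon_d [u def_u] [v def_v].
split; apply: (@divides_Zpoly_mulrn _ _ 2) => //.
  by exists (u + v); rewrite mulrDl -def_u -def_v; ring.
by exists (u - v); rewrite mulrBl -def_u -def_v; ring.
Qed.

Theorem theorem3 (n m : nat) (hn : (4 <= n)%N) (hm : m = ((n - 2) %/ 2)%N) :
  ((n %% 4 = 0)%N \/ (n %% 4 = 1)%N ->
     divides_Zpoly ((1 + 'X) ^+ (m - 1)) (Rplus n) /\
     divides_Zpoly ((1 + 'X) ^+ (m - 1)) (Rminus n)) /\
  ((n %% 4 = 2)%N \/ (n %% 4 = 3)%N ->
     divides_Zpoly ((1 + 'X) ^+ m) (Rplus n) /\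
     divides_Zpoly ((1 + 'X) ^+ m) (Rminus n)).
Proof.
case: n => // n in hn hm *.
have mon k : ((1 + 'X : {poly int}) ^+ k) \is monic by rewrite monic_exp ?monic_1DX.
have [q R_eq] : divides_Zpoly ((1 + 'X) ^+ m) (\sum_(s : 'S_n.+1) 'X^(altruns s)).
  by apply: divides_sum_altruns; lia.
split=> n_mod4; apply: divides_Zpoly_halves;
  rewrite ?mon ?Rplus_add_Rminus ?Rplus_sub_Rminus //.
(* Here [m] is positive because [n.+1] is at least 4, so one factor can be split off. *)
- exists (q * (1 + 'X)); rewrite R_eq -mulrA -exprS.
  by congr (_ * _ ^+ _); lia.
- have -> : (m - 1 = n.+1./2 - 2)%N by lia.
  exact: divides_signed_sum_altruns.
- by exists q.
- by exists 0; rewrite mul0r signed_sum_altruns_eq0 //; case: n_mod4 => ->.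
Qed.
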